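(* Let $T$ be a non-trivial tree and let $\Gamma$ be an abelian group with $|\Gamma|=|V(T)|$. Then $T$ is $\Gamma$-distance magic if and only if $T\cong K_{1,n}$ for some positive integer $n$ with $n\not\equiv 1 \pmod 4$.
   Context: All graphs are finite and simple; all groups are finite additive abelian groups. A tree is non-trivial if it has at least two vertices. $N_G(u)$ is the set of vertices adjacent to $u$ in $G$. For a graph $G$ and an abelian group $\Gamma$ with $|V(G)|=|\Gamma|$, a $\Gamma$-distance magic labeling of $G$ is a bijection $l:V(G)\to\Gamma$ for which there is an element $\mu_0\in\Gamma$ such that $w_G(u)=\sum_{v\in N_G(u)}l(v)=\mu_0$ for every $u\in V(G)$; $G$ is $\Gamma$-distance magic if it admits such a labeling. $K_{1,n}$ is the star with $n$ leaves. *)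

(* Defs.v *)
From HB Require Import structures.
From mathcomp Require Import all_boot all_order all_algebra.
Set Implicit Arguments.
Unset Strict Implicit.
Unset Printing Implicit Defensive.

Import GRing.Theory.
Local Open Scope ring_scope.

Record sgraph := SGraph {
  vertex :> finType;
  adj : rel vertex;
  adj_sym : symmetric adj;
  adj_irrefl : irreflexive adj
}.

Definition nbh (G : sgraph) (u : G) : {set G} := [set v | adj u v].

Definition connected_graph (G : sgraph) : Prop :=
  (0 < #|G|)%N /\ forall u v : G, connect (@adj G) u v.

(* [ucycle] also accepts the empty sequence and, since [adj] is symmetric,
   the two ends of an edge; genuine cycles have at least 3 vertices. *)
Definition acyclic (G : sgraph) : Prop :=
  forall c : seq G, (2 < size c)%N -> ~ ucycle (@adj G) c.

Definition is_tree (G : sgraph) : Prop := connected_graph G /\ acyclic G.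

Definition graph_iso (G H : sgraph) : Prop :=
  exists f : G -> H, bijective f /\ forall u v, adj (f u) (f v) = adj u v.

(* The centre is [None]; the leaves are [Some i] for [i : 'I_n]. *)
Definition star_adj (n : nat) : rel (option 'I_n) :=
  fun u v => (u == None) != (v == None).

Lemma star_adj_sym n : symmetric (@star_adj n).
Proof. by move=> u v; rewrite /star_adj eq_sym. Qed.

Lemma star_adj_irrefl n : irreflexive (@star_adj n).
Proof. by move=> u; rewrite /star_adj eqxx. Qed.

Definition star (n : nat) : sgraph :=
  SGraph (@star_adj_sym n) (@star_adj_irrefl n).

Definition weight (G : sgraph) (Gamma : finZmodType) (l : G -> Gamma) (u : G)
    : Gamma :=
  \sum_(v in nbh u) l v.

Definition distance_magic_labeling (G : sgraph) (Gamma : finZmodType)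
    (l : G -> Gamma) : Prop :=
  bijective l /\ exists mu0 : Gamma, forall u : G, weight l u = mu0.

Definition distance_magic (G : sgraph) (Gamma : finZmodType) : Prop :=
  exists l : G -> Gamma, distance_magic_labeling l.

(* Main.v *)
(* A leaf has the label of its neighbour as weight, so in a distance magic tree
   all leaves have the same neighbour [c].  A simple path ending at [c] extends
   backwards until it starts at a leaf, whose neighbour must be [c]; hence the
   path has length at most 1 and the tree is a star centred at [c].
   A labeling [l] of a star is magic iff [2 l(c)] is the sum [s] of all elements
   of Gamma.  If [a] is an involution, pairing [x] with [x + a] gives
   [s = 2 r + (|Gamma| / 2) a].  Hence [s] is a double if [4] divides [|Gamma|];
   if [|Gamma| = 2 mod 4], then [s] a double would make [a] a double, that is,
   give an element of order 4.  For odd [|Gamma|] everything is a double. *)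
Require Import Defs.
From mathcomp Require Import all_boot all_order all_algebra.
From mathcomp Require Import all_fingroup all_solvable.
From mathcomp Require Import zify.

(** A transposition corrects any bijection at [x]. This serves to send the centre of a star to
    [None], or to a prescribed label. *)
Lemma bijection_at (A B : finType) (x : A) (y : B) :
  #|A| = #|B| -> exists2 f : A -> B, bijective f & f x = y.
Proof.
move=> eqAB; have [g bij_g] : exists g : A -> B, bijective g.
  have leAB : #|B| <= #|A| by rewrite eqAB.
  exists (fun a => enum_val (cast_ord eqAB (enum_rank a))).
  apply: inj_card_bij => // a b /enum_val_inj/cast_ord_inj; exact: enum_rank_inj.
exists (tperm (g x) y \o g); last by rewrite /= tpermL.
by apply: bij_comp => //; exists (tperm (g x) y) => z; rewrite tpermK.
Qed.

Section FiniteAbelianGroup.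
Import GRing.Theory.
Local Open Scope ring_scope.
Variable V : finZmodType.
Implicit Types x a : V.

(** Translation by [x] permutes [V], so it preserves the sum of all elements. *)
Lemma mulrn_card x : x *+ #|V| = 0.
Proof.
apply: (addIr (\sum_(y : V) y)); rewrite add0r -sumr_const -big_split /=.
by rewrite [RHS](reindex_inj (addrI x)).
Qed.

Lemma even_card_involution : ~~ odd #|V| -> exists2 a : V, a != 0 & a + a = 0.
Proof.
move=> evV; have := Cauchy (G := [set: V]%G) (isT : prime 2).
rewrite cardsT dvdn2 => /(_ evV) [a _ oa]; exists a.
  by apply/eqP => a0; move: oa; rewrite a0 -(FinRing.zmod1gE V) order1.
by have := expg_order a; rewrite oa FinRing.zmodXgE FinRing.zmod1gE mulr2n.
Qed.

Lemma sum_involution a : a != 0 -> a + a = 0 ->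
  exists r m, #|V| = m.*2 /\ \sum_(x : V) x = r *+ 2 + a *+ m.
Proof.
(* [A] takes from each pair [x], [x + a] the element of smaller rank. *)
move=> a0 aa; pose A := [set x : V | enum_rank x < enum_rank (x + a)%R]%N.
have addKa x : x + a + a = x by rewrite -addrA aa addr0.
have inA x : (x + a \in A) = (x \notin A).
  rewrite !inE addKa -leqNgt ltn_neqAle; apply/andb_idl => _.
  apply: contra a0 => /eqP/ord_inj/enum_rank_inj xa.
  by apply/eqP/(addrI x); rewrite addr0.
have aI : injective (fun x => x + a) := addIr a.
have cardA : #|V| = #|A|.*2.
  rewrite -(cardC A) -addnn; congr addn.
  rewrite -!sum1_card (reindex_inj aI) /=.
  by apply: eq_bigl => x; rewrite -[LHS]/(x + a \notin A) inA negbK.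
exists (\sum_(x in A) x), #|A|; split=> //.
rewrite (bigID (mem A)) /= mulr2n -addrA; congr (_ + _).
rewrite (reindex_inj aI) -sumr_const -big_split /=.
by apply: eq_bigl => x; rewrite inA negbK.
Qed.

Lemma sum_is_double :
  (exists x, x *+ 2 = \sum_(y : V) y) <-> (#|V| <> 2 %[mod 4])%N.
Proof.
have [oddV | evenV] := boolP (odd #|V|).
  split=> [_ | _]; first by lia.
  (* For [#|V|] = 2k + 1 the factor is k + 1: doubling it gives [#|V|] + 1, and [#|V|] annihilates
     the group. *)
  exists ((\sum_(y : V) y) *+ #|V|./2.+1); rewrite -mulrnA.
  have -> : (#|V|./2.+1 * 2 = #|V|.+1)%N by lia.
  by rewrite mulrS mulrn_card addr0.
have [a a0 aa] := even_card_involution evenV.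
have aX m : a *+ m = a *+ odd m.
  by rewrite -{1}(odd_double_half m) mulrnDr -mul2n mulrnA mulr2n aa mul0rn addr0.
have [r [m [cardV ->]]] := sum_involution _ a0 aa; rewrite (aX m).
split=> [[x xE] card2 | cardN2]; last first.
  have -> : odd m = false by lia.
  by exists r; rewrite addr0.
have om : odd m by lia.
have {}xE : (x - r) *+ 2 = a by rewrite mulrnBl xE om addrC addKr.
(* Since [#|V|] = 2m with [m] odd, this multiple of [x - r] equals [a], yet it must vanish. *)
have := mulrn_card (x - r).
by rewrite cardV -mul2n mulrnA xE aX om => /eqP; rewrite (negPf a0).
Qed.

End FiniteAbelianGroup.

(** An intrinsic form of being a star, modelled on [star_adj]; labelings need not be transported
    along an isomorphism. *)
Definition star_center [G : sgraph] (c : G) : Prop :=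
  forall u v : G, adj u v = ((u == c) != (v == c)).

Lemma star_center_iso (G : sgraph) (n : nat) :
  graph_iso G (star n) <-> #|G| = n.+1 /\ exists c : G, star_center c.
Proof.
split=> [[f [bij_f fE]] | [cardG [c cE]]].
  split; first by rewrite (bij_eq_card bij_f) card_option card_ord.
  have [g fK gK] := bij_f; exists (g None) => u v.
  by rewrite -fE /= /star_adj !(can2_eq fK gK).
have [|f bij_f fc] := bijection_at G (option 'I_n) c None.
  by rewrite cardG card_option card_ord.
exists f; split=> // u v.
by rewrite cE /= /star_adj -fc !(inj_eq (bij_inj bij_f)).
Qed.

Section StarLabeling.
Import GRing.Theory.
Local Open Scope ring_scope.

(** The centre has as weight the sum of all elements minus [l c], and every leaf has weight
    [l c]. *)
Lemma star_labeling (G : sgraph) (Gamma : finZmodType) (c : G)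
    (l : G -> Gamma) :
  star_center c -> (1 < #|G|)%N -> bijective l ->
  (distance_magic_labeling l <-> l c *+ 2 = \sum_(x : Gamma) x).
Proof.
move=> cE G_gt1 bij_l.
have wc : \sum_(x : Gamma) x = l c + weight l c.
  rewrite (reindex l) /=; last exact: onW_bij.
  rewrite (bigD1 c) //=; congr (_ + _); apply: eq_bigl => v.
  by rewrite inE cE eqxx; case: (v == c).
have wl u : u != c -> weight l u = l c.
  move=> /negPf uc; rewrite /weight (big_pred1 c) // => v.
  by rewrite inE cE uc /=; case: (v == c).
split=> [[_ [mu muE]] | lc].
  have [u uc] : exists u, u != c.
    have : (0 < #|predC1 c|)%N by rewrite cardC1 -ltnS prednK // ltnW.
    by case/card_gt0P=> u; exists u.
  by rewrite wc mulr2n muE -(muE u) wl.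
split=> //; exists (l c) => u; have [-> | /wl //] := eqVneq u c.
by apply: (addrI (l c)); rewrite -wc -lc mulr2n.
Qed.

(** Any group element can be made the label of the centre, so only solvability of the doubling
    equation matters. *)
Lemma star_distance_magic (G : sgraph) (Gamma : finZmodType) (c : G) :
  star_center c -> (1 < #|G|)%N -> #|Gamma| = #|G| ->
  (distance_magic G Gamma <-> (#|G| <> 2 %[mod 4])%N).
Proof.
move=> cE G_gt1 card_eq; rewrite -card_eq -sum_is_double.
split=> [[l l_magic] | [x xE]].
  by exists (l c); apply/(star_labeling _ _ _ _ cE G_gt1 l_magic.1).
have [l bij_l lc] := bijection_at _ _ c x (esym card_eq).
by exists l; apply/(star_labeling _ _ _ _ cE G_gt1 bij_l); rewrite lc.
Qed.

End StarLabeling.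

(* If [z] has a neighbour other than [y], acyclicity puts it outside the path,
   so the path can be prolonged. *)
Lemma extend_to_leaf (G : sgraph) (z y : G) (s : seq G) :
  acyclic G -> path (@adj G) z (y :: s) -> uniq (z :: y :: s) ->
  exists t z' y' s', [/\ z' :: y' :: s' = t ++ z :: y :: s,
    uniq (z' :: y' :: s') & nbh z' = [set y']].
Proof.
move=> acG; have [k] := ubnP (#|G| - size s).
elim: k z y s => // k IHk z y s le_k pzs uzs.
have [/subsetP sub_y | /subsetPn[w]] := boolP (nbh z \subset [set y]).
  exists [::], z, y, s; split=> //; apply/setP => w.
  apply/idP/idP => [/sub_y // | /set1P ->].
  by case/andP: pzs; rewrite inE.
rewrite !inE => zw wy.
have wz : adj w z by rewrite adj_sym.
have ws : w \notin s.
  (* Otherwise the stretch of the path from [z] through [y] to [w], closed by the edge from [w] to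
     [z], is a cycle. *)
  apply/negP => ws; case/splitPr: ws pzs uzs {le_k} => s1 s2 pzs uzs.
  have /acG[] : 2 < size [:: z, y & rcons s1 w] by rewrite /= size_rcons.
  move: pzs uzs; rewrite -cat_rcons -!cat_cons cat_path cat_uniq.
  case/andP=> pz _ /andP[uz _]; apply/andP; split=> //.
  by rewrite (cycle_path z) /= last_rcons wz.
have uw : uniq (w :: z :: y :: s).
  rewrite cons_uniq uzs andbT !inE !negb_or wy ws !andbT.
  by apply: contraTneq wz => ->; rewrite adj_irrefl.
(* Makes the truncated difference [#|G| - size s] drop strictly when the path grows, as the
   induction requires. *)
have size_s : size s < #|G|.
  by apply: leq_trans (max_card (mem (z :: s))); rewrite (card_uniqP _) //;
    move: uzs; rewrite /= inE negb_or -andbA => /and4P[_ -> _ ->].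
have [] := IHk w z (y :: s) _ _ uw; first by rewrite /= subnSK.
  by rewrite /= wz.
move=> t [z' [y' [s' [eq_s us' leaf]]]].
by exists (rcons t w), z', y', s'; split; rewrite // cat_rcons.
Qed.

Lemma distance_magic_tree_star (G : sgraph) (Gamma : finZmodType) :
  is_tree G -> 1 < #|G| -> distance_magic G Gamma ->
  exists c : G, star_center c.
Proof.
move=> [[G_gt0 conG] acG] G_gt1 [l [/bij_inj l_inj [mu muE]]].
have leaf_nbr u v : nbh u = [set v] -> l v = mu.
  by move=> leaf; rewrite -(muE u) /weight leaf big_set1.
have simple_path u v : u != v -> exists y s,
    [/\ path (@adj G) u (y :: s), uniq (u :: y :: s) & last y s = v].
  have /connectP[p pp ->] := conG u v; case/shortenP: pp => -[|y s].
    by rewrite eqxx.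
  by move=> ps us _ _; exists y, s.
have [c lc] : exists c, l c = mu.
  have [u [v [_ _ uv]]] := card_gt1P G_gt1.
  have [y [s [ps us _]]] := simple_path u v uv.
  have [_ [z [c [_ [_ _ leaf]]]]] := extend_to_leaf _ _ _ _ acG ps us.
  by exists c; exact: leaf_nbr leaf.
have adj_c u : u != c -> adj u c.
  move=> /simple_path[y [s [ps us sc]]].
  have [t [z [y' [s' [eq_s us' /leaf_nbr]]]]] := extend_to_leaf _ _ _ _ acG ps us.
  rewrite -lc => /l_inj y'c; subst y'.
  (* [c] is both second and last on the extended path; as no vertex repeats, that path is just [z],
     [c]. *)
  have : last z (c :: s') = c.
    by rewrite -[LHS]/(last z (z :: c :: s')) eq_s last_cat.
  case: s' eq_s us' => [|x s'] eq_s us'; last first.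
    move=> /= last_c; move: us'; rewrite 2!cons_uniq => /and3P[_ + _].
    by rewrite -{1}last_c mem_last.
  (* A path of two vertices leaves no room for an extension [t], so [u] is the leaf [z] itself. *)
  case: t eq_s => [|? [|? [|? ?]]] //= [uz yc _] _.
  by move: ps; rewrite yc /= => /andP[].
exists c; move=> u v.
have [-> | uc] := eqVneq u c; have [-> | vc] := eqVneq v c.
- by rewrite adj_irrefl.
- by rewrite adj_sym adj_c.
- by rewrite adj_c.
apply/negP => uv; apply: (acG [:: c; u; v]) => //.
rewrite /ucycle /= uv !inE negb_or ![c == _]eq_sym uc vc adj_sym !adj_c //=.
by rewrite andbT; apply: contraTneq uv => ->; rewrite adj_irrefl.
Qed.

Theorem theorem2p1 (T : sgraph) (Gamma : finZmodType)
    (T_tree : is_tree T) (T_nontrivial : 1 < #|T|)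
    (card_Gamma : #|Gamma| = #|T|) :
  distance_magic T Gamma <->
  exists n : nat, [/\ 0 < n, n <> 1 %[mod 4] & graph_iso T (star n)].
Proof.
split=> [magicT | [n [n_gt0 n_mod /star_center_iso[cardT [c cE]]]]].
  have [c cE] := distance_magic_tree_star _ _ T_tree T_nontrivial magicT.
  have cardT : #|T| = #|T|.-1.+1 by rewrite prednK // ltnW.
  (* As [#|T|] = n + 1, the residue 2 excluded for [#|T|] is the residue 1 excluded for n. *)
  exists #|T|.-1; split; last by apply/star_center_iso; split=> //; exists c.
    by lia.
  by move/(star_distance_magic _ _ _ cE T_nontrivial card_Gamma): magicT; lia.
by apply/(star_distance_magic _ _ _ cE T_nontrivial card_Gamma); lia.
Qed.
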